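(* Let $\mathcal{C}$ be a nondegenerate $[n,3]_{q^m/q}$ code with $n\ge m+2$ and let $\mathcal{U}$ be any $[n,3]_{q^m/q}$ system corresponding to $\mathcal{C}$. If the linear set $L_{\mathcal{U}}$ is scattered, then $\mathcal{C}$ is a minimal rank-metric code.
   Context: Let $q$ be a prime power and $n,m,k$ positive integers. For $v\in\mathbb{F}_{q^m}^n$ and an ordered basis $\Gamma=(\gamma_1,\dots,\gamma_m)$ of $\mathbb{F}_{q^m}$ over $\mathbb{F}_q$, let $\Gamma(v)\in\mathbb{F}_q^{n\times m}$ be the matrix with $v_i=\sum_{j}\Gamma(v)_{ij}\gamma_j$. The rank support $\sigma^{\mathrm{rk}}(v)\subseteq\mathbb{F}_q^n$ is the column space of $\Gamma(v)$ (independent of $\Gamma$). An $[n,k]_{q^m/q}$ code is a $k$-dimensional $\mathbb{F}_{q^m}$-subspace $\mathcal{C}\subseteq\mathbb{F}_{q^m}^n$; it is nondegenerate if $\sum_{v\in\mathcal{C}}\sigma^{\mathrm{rk}}(v)=\mathbb{F}_q^n$, and minimal if for all $v,v'\in\mathcal{C}$, $\sigma^{\mathrm{rk}}(v')\subseteq\sigma^{\mathrm{rk}}(v)$ implies $v'=\alpha v$ for some $\alpha\in\mathbb{F}_{q^m}$. An $[n,k]_{q^m/q}$ system is an $n$-dimensional $\mathbb{F}_q$-subspace $\mathcal{U}\subseteq\mathbb{F}_{q^m}^k$ with $\langle\mathcal{U}\rangle_{\mathbb{F}_{q^m}}=\mathbb{F}_{q^m}^k$. A system corresponding to a nondegenerate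 code $\mathcal{C}$ is the $\mathbb{F}_q$-span of the columns of a generator matrix $G\in\mathbb{F}_{q^m}^{k\times n}$ of $\mathcal{C}$. The linear set of $\mathcal{U}$ is $L_{\mathcal{U}}=\{\langle u\rangle_{\mathbb{F}_{q^m}}:u\in\mathcal{U}\setminus\{0\}\}\subseteq\mathrm{PG}(k-1,q^m)$. It always satisfies $|L_{\mathcal{U}}|\le\frac{q^n-1}{q-1}$ and is called scattered if equality holds, equivalently if $\dim_{\mathbb{F}_q}(\mathcal{U}\cap P)=1$ for every $P\in L_{\mathcal{U}}$ (viewing $P$ as a $1$-dimensional $\mathbb{F}_{q^m}$-subspace). *)

(* Defs.v *)
From HB Require Import structures.
From mathcomp Require Import all_boot all_order all_algebra all_field.

Set Implicit Arguments.
Unset Strict Implicit.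
Unset Printing Implicit Defensive.

Import GRing.Theory.

Local Open Scope ring_scope.

(* F is F_q and L is an extension of F of finite degree m, so that L is
   F_{q^m}. [finvect_type L] is L itself, seen both as a finite field and as a
   field extension of F; all codes and systems are taken over it. *)
Section RankMetric.

Variables (F : finFieldType) (L : fieldExtType F).
Local Notation K := (finvect_type L).

Section Codes.

Variable n : nat.

Definition expansion_mx m (G : m.-tuple K) (v : 'rV[K]_n) : 'M[F]_(n, m) :=
  \matrix_(i, j) coord G j (v 0 i).

Definition column_space m (A : 'M[F]_(n, m)) : {vspace 'cV[F]_n} :=
  <<[seq col j A | j : 'I_m]>>%VS.

Definition rank_support (v : 'rV[K]_n) : {vspace 'cV[F]_n} :=
  column_space (expansion_mx (vbasis {:K}) v).

Lemma rank_support_basis m (G : m.-tuple K) (v : 'rV[K]_n) :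
  basis_of {:K} G -> rank_support v = column_space (expansion_mx G v).
Proof.
have sub m1 m2 (G1 : m1.-tuple K) (G2 : m2.-tuple K) :
    basis_of {:K} G1 -> basis_of {:K} G2 ->
  (column_space (expansion_mx G1 v) <= column_space (expansion_mx G2 v))%VS.
  move=> bG1 bG2; apply/span_subvP => _ /mapP[j _ ->].
  suff -> : col j (expansion_mx G1 v) =
      \sum_(i < m2) coord G1 j G2`_i *: col i (expansion_mx G2 v).
    apply: memv_suml => i _; apply/memvZ/memv_span/mapP.
    by exists i; rewrite ?mem_enum.
  apply/colP => i; rewrite summxE !mxE.
  rewrite {1}(coord_basis bG2 (memvf (v 0 i))) linear_sum /=.
  by apply: eq_bigr => l _; rewrite !mxE linearZ mulrC.
move=> bG; apply/eqP; rewrite eqEsubv.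
by rewrite !sub ?vbasisP.
Qed.

Definition is_code (k : nat) (C : {vspace 'rV[K]_n}) : Prop := \dim C = k.

Definition nondegenerate_code (C : {vspace 'rV[K]_n}) : Prop :=
  (\sum_(v : 'rV[K]_n | v \in C) rank_support v)%VS = fullv.

Definition minimal_code (C : {vspace 'rV[K]_n}) : Prop :=
  forall v v' : 'rV[K]_n, v \in C -> v' \in C ->
    (rank_support v' <= rank_support v)%VS -> exists a : K, v' = a *: v.

Definition generator_matrix k (C : {vspace 'rV[K]_n}) (G : 'M[K]_(k, n)) :=
  basis_of C [seq row i G | i : 'I_k].

End Codes.

(* K^k carries two vector space structures here: {ffun 'I_k -> K} has the
   F-structure (the one induced by K as a vector space over F), whereas
   'cV[K]_k has the K-structure. [colv] is the identification of the two. *)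
Section Systems.

Variable k : nat.
Local Notation Kk := {ffun 'I_k -> K}.

Definition colv (u : Kk) : 'cV[K]_k := \col_i u i.

Definition is_system (n : nat) (U : {vspace Kk}) : Prop :=
  \dim U = n /\ <<[seq colv u | u in U]>>%VS = {: 'cV[K]_k}%VS.

(* A point of PG(k-1, q^m), i.e. the line <u>_K of K^k, is given by the finite
   set of its vectors, so that linear sets have a cardinality. *)
Definition proj_point (u : Kk) : {set 'cV[K]_k} :=
  [set x | x \in <[colv u]>%VS].

Definition linear_set (U : {vspace Kk}) : {set {set 'cV[K]_k}} :=
  [set proj_point u | u in U & u != 0].

Definition scattered (U : {vspace Kk}) : Prop :=
  #|linear_set U| = ((#|F| ^ \dim U - 1) %/ (#|F| - 1))%N.

Definition column_system n (G : 'M[K]_(k, n)) : {vspace Kk} :=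
  <<[seq [ffun i => G i j] | j : 'I_n]>>%VS.

Definition corresponding_system n (C : {vspace 'rV[K]_n}) (U : {vspace Kk}) :=
  exists2 G : 'M[K]_(k, n), generator_matrix C G & U = column_system G.

End Systems.

End RankMetric.

(* Main.v *)
(* Codewords are v = x G with x in K^3, and l in F^n is orthogonal to the rank
   support of v iff the vector G l of U lies in the hyperplane x^perp. Hence, if
   the support of v' = x' G is contained in that of v, then U \cap x^perp lies
   in x'^perp. As dim_F (U \cap x^perp) >= n - m >= 2 and U meets each point of
   PG(2, q^m) in dimension at most 1, U \cap x^perp contains two K-independent
   vectors, so x^perp \cap x'^perp has dimension at least 2 in K^3 and x, x'
   are proportional. *)
Require Import Defs.
From HB Require Import structures.
From mathcomp Require Import all_boot all_order all_algebra all_field.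

Import GRing.Theory.

Local Open Scope ring_scope.

Section RankMetric.

Set Implicit Arguments.
Unset Strict Implicit.

Lemma rank_col_mx_le1 (K : fieldType) (k : nat) (x y : 'rV[K]_k) :
  x != 0 -> (\rank (col_mx x y) <= 1)%N -> exists a, y = a *: x.
Proof.
move=> x0 rk; apply/sub_rVP.
have /mxrank_leqif_sup : (x <= col_mx x y)%MS by rewrite -addsmxE addsmxSl.
case=> le_rk eq_rk; move: eq_rk; rewrite rank_rV x0 in le_rk *.
by rewrite eqn_leq le_rk rk -addsmxE addsmx_sub => /esym/andP[].
Qed.

Variables (F : finFieldType) (L : fieldExtType F).
Local Notation K := (finvect_type L).

Lemma card_nonzero_vspace k (U : {vspace {ffun 'I_k -> K}}) :
  #|[set u in U | u != 0]| = (#|F| ^ \dim U - 1)%N.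
Proof.
have -> : [set u in U | u != 0] = [set u in U] :\ (0 : {ffun 'I_k -> K}).
  by apply/setP => u; rewrite !in_setD1 !in_set andbC.
have := cardsD1 (0 : {ffun 'I_k -> K}) [set u in U].
by rewrite cardsE card_vspace in_set mem0v => ->; rewrite addKn.
Qed.

Lemma proj_pointZ k (c : F) (u : {ffun 'I_k -> K}) :
  c != 0 -> proj_point (c *: u) = proj_point u.
Proof.
move=> c0; have c0' : (c%:A : K) != 0 by rewrite scaler_eq0 oner_eq0 orbF.
have colvZ : colv (c *: u) = (c%:A : K) *: colv u.
  by apply/colP => i; rewrite !mxE ffunE mulr_algl.
apply/setP => x; rewrite !inE colvZ.
apply/vlineP/vlineP => [[b ->]|[b ->]].
  by exists (b * c%:A); rewrite scalerA.
by exists (b / c%:A); rewrite scalerA divfK.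
Qed.

(* The map sending a nonzero vector of U to its point has fibres of size at
   least q - 1, being invariant under F^*; scattered means that all the fibres
   have exactly this size. *)
Lemma scattered_proj_point_inj k (U : {vspace {ffun 'I_k -> K}})
    (u w : {ffun 'I_k -> K}) :
    scattered U -> u \in U -> w \in U -> u != 0 -> w != 0 ->
  proj_point u = proj_point w -> w \in <[u]>%VS.
Proof.
move=> scU uU wU u0 w0 puw.
pose D := [set u in U | u != 0].
pose fibre P := [set t in D | proj_point t == P].
have LE : linear_set U = [set proj_point t | t in D].
  by apply/setP => P; apply/imsetP/imsetP => -[t tD ->]; exists t => //;
     move: tD; rewrite !inE.
pose line (t : {ffun 'I_k -> K}) := [set s in <[t]>%VS | s != 0].
have subfib t : t \in D -> line t \subset fibre (proj_point t).
  rewrite inE => /andP[tU t0]; apply/subsetP => s.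
  rewrite !inE => /andP[/vlineP[c ->] ct0]; rewrite memvZ //= ct0 /=.
  by move: ct0; rewrite scaler_eq0 negb_or => /andP[c0 _]; rewrite proj_pointZ.
have cardline t : t \in D -> #|line t| = (#|F| - 1)%N.
  by rewrite inE => /andP[_ t0]; rewrite card_nonzero_vspace dim_vline t0 expn1.
have lefib P : P \in linear_set U ->
    (#|F| - 1 <= #|fibre P| ?= iff (#|F| - 1 == #|fibre P|))%N.
  rewrite LE => /imsetP[t tD ->]; apply/leqif_eq.
  by rewrite -(cardline t tD) subset_leq_card // subfib.
have uD : u \in D by rewrite inE uU u0.
(* Summed over all points, the bound compares (q - 1) times the number of points with the number of
   nonzero vectors of [U]. Scatteredness makes the two equal, which forces equality in every
   fibre. *)
have [_] := leqif_sum lefib.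
rewrite sum_nat_const scU divnK; last first.
  (* The quotient is exact: writing 1 as a power of 1 lets q - 1 be factored out. *)
  by rewrite -{2}(exp1n (\dim U)) subn_exp dvdn_mulr.
have -> : (\sum_(P in linear_set U) #|fibre P| = #|D|)%N.
  rewrite -sum1_card (partition_big_imset (@proj_point F L k)) -LE /=.
  by apply: eq_bigr => P _; rewrite -sum1_card; apply: eq_bigl => t;
     rewrite !inE.
rewrite card_nonzero_vspace eqxx => /esym/forall_inP /(_ (proj_point u)).
rewrite LE imset_f // -(cardline u uD) => /(_ isT)/eqP cardfib.
have /eqP/setP/(_ w) : line u == fibre (proj_point u).
  by rewrite eqEcard subfib //= cardfib.
by rewrite !inE wU w0 puw eqxx => /andP[].
Qed.

(** The coordinates of an F-combination of the entries of [v] are the products of the row [l] with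
    the columns of the expansion matrix. So the relation says that [l] annihilates the support of
    [v], hence any smaller support. *)
Lemma rank_support_orthogonal n (v v' : 'rV[K]_n) (l : 'I_n -> F) :
    (rank_support v' <= rank_support v)%VS ->
  \sum_j l j *: v 0 j = 0 -> \sum_j l j *: v' 0 j = 0.
Proof.
pose B := vbasis {: K}; pose lr := \row_j l j.
have lrE (w : 'rV[K]_n) (i : 'I_(\dim {:K})) :
    lr *m col i (expansion_mx B w) = (coord B i (\sum_j l j *: w 0 j))%:M.
  apply/rowP => z; rewrite !ord1 !mxE eqxx mulr1n linear_sum /=.
  by apply: eq_bigr => j _; rewrite !mxE linearZ.
pose f : 'Hom('cV[F]_n, 'M[F]_1) := linfun (mulmx lr).
move=> sub v0.
have kf : (rank_support v <= lker f)%VS.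
  apply/span_subvP => _ /mapP[i _ ->].
  by rewrite memv_ker lfunE /= lrE v0 linear0 raddf0.
rewrite (coord_vbasis (memvf (\sum_j l j *: v' 0 j))) big1 // => i _.
have : col i (expansion_mx B v') \in lker f.
  apply: (subvP (subv_trans sub kf)); apply/memv_span/mapP.
  by exists i; rewrite ?mem_enum.
rewrite memv_ker lfunE /= lrE => /eqP/matrixP/(_ 0 0).
by rewrite !mxE eqxx mulr1n => ->; rewrite scale0r.
Qed.

Lemma generator_matrix_mulmx n k (C : {vspace 'rV[K]_n}) (G : 'M[K]_(k, n)) v :
  generator_matrix C G -> v \in C -> exists x : 'rV[K]_k, v = x *m G.
Proof.
move=> /andP[/eqP CG _].
have : (C <= limg (linfun (mulmxr G)))%VS.
  rewrite -CG; apply/span_subvP => _ /mapP[i _ ->].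
  by apply/memv_imgP; exists (delta_mx 0 i); rewrite ?memvf // lfunE /= rowE.
by move=> /subvP/[apply]/memv_imgP[x _ ->]; exists x; rewrite lfunE.
Qed.

(* Linear over F only: the domain carries its F-structure. *)
Definition dot k (x : 'rV[K]_k) (u : {ffun 'I_k -> K}) : K :=
  (x *m colv u) 0 0.

Lemma dotE k (x : 'rV[K]_k) u : dot x u = \sum_i x 0 i * u i.
Proof. by rewrite /dot mxE; apply: eq_bigr => i _; rewrite !mxE. Qed.

Lemma mulmx_colv k (x : 'rV[K]_k) u : (x *m colv u == 0) = (dot x u == 0).
Proof.
by rewrite [x *m _]mx11_scalar -scalemx1 scaler_eq0 oner_eq0 orbF.
Qed.

Lemma dot_is_linear k (x : 'rV[K]_k) : linear (dot x).
Proof.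
move=> c u w; rewrite !dotE scaler_sumr -big_split /=; apply: eq_bigr => i _.
by rewrite !ffunE mulrDr scalerAr.
Qed.

HB.instance Definition _ k (x : 'rV[K]_k) :=
  GRing.isLinear.Build F {ffun 'I_k -> K} K *:%R (dot x) (dot_is_linear x).

Lemma rank_support_dot n k (G : 'M[K]_(k, n)) (x x' : 'rV[K]_k)
    (u : {ffun 'I_k -> K}) :
    (rank_support (x' *m G) <= rank_support (x *m G))%VS ->
  u \in column_system G -> dot x u = 0 -> dot x' u = 0.
Proof.
move=> sub uU.
(* Coefficients for [u] come from the fact that [column_system G] lies in the image of F^n under the
   F-linear map sending l to G l. *)
have [l ->] : exists l : 'I_n -> F, u = \sum_j l j *: [ffun i => G i j].
  pose f (l : 'rV[F]_n) : {ffun 'I_k -> K} :=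
    \sum_j l 0 j *: [ffun i => G i j].
  have f_lin : linear f.
    move=> c l l'; rewrite /f scaler_sumr -big_split; apply: eq_bigr => j _.
    by rewrite !mxE scalerDl scalerA.
  pose f_isLin := GRing.isLinear.Build F 'rV[F]_n {ffun 'I_k -> K} *:%R f f_lin.
  pose fl : {linear 'rV[F]_n -> {ffun 'I_k -> K}} :=
    HB.pack_for {linear 'rV[F]_n -> {ffun 'I_k -> K}} f f_isLin.
  have : (column_system G <= limg (linfun fl))%VS.
    apply/span_subvP => _ /mapP[j _ ->]; apply/memv_imgP.
    exists (delta_mx 0 j); rewrite ?memvf // lfunE /= /f (bigD1 j) //=.
    rewrite mxE !eqxx scale1r big1 ?addr0 // => i /negPf ij.
    by rewrite mxE ij scale0r.
  by move=> /subvP/(_ _ uU)/memv_imgP[l _ ->]; exists (l 0); rewrite lfunE.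
have dotG (y : 'rV[K]_k) :
    dot y (\sum_j l j *: [ffun i => G i j]) = \sum_j l j *: (y *m G) 0 j.
  rewrite linear_sum; apply: eq_bigr => j _; rewrite linearZ /= dotE mxE.
  by congr (_ *: _); apply: eq_bigr => i _; rewrite ffunE.
by rewrite !dotG; apply: rank_support_orthogonal.
Qed.

(** Proportionality over K goes through [colv], as [u] and [w] live in the F-structure. That [w] is
    nonzero makes [b] invertible. *)
Lemma proj_point_scale k (u w : {ffun 'I_k -> K}) (b : K) :
  w != 0 -> colv w = b *: colv u -> proj_point u = proj_point w.
Proof.
move=> w0 wu; have b0 : b != 0.
  apply: contraNneq w0 => b0; apply/eqP/ffunP => i; rewrite ffunE.
  by move/colP: wu => /(_ i); rewrite b0 !mxE mul0r.
apply/setP => t; rewrite !inE wu; apply/vlineP/vlineP => [[c ->]|[c ->]].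
  by exists (c / b); rewrite scalerA divfK.
by exists (c * b); rewrite scalerA.
Qed.

(** Rank-nullity over F: the values of [dot x] lie in K, so the image has F-dimension at most m. *)
Lemma dim_lker_dot k (x : 'rV[K]_k) (U : {vspace {ffun 'I_k -> K}}) :
  (\dim U - \dim {: L} <= \dim (U :&: lker (linfun (dot x))))%N.
Proof.
rewrite leq_subLR -(limg_ker_dim (linfun (dot x)) U) addnC leq_add2r.
by rewrite -[\dim {: L}]/(\dim {: K}) dimvS ?subvf.
Qed.

Lemma scattered_rank2 k (U : {vspace {ffun 'I_k -> K}}) (x : 'rV[K]_k) :
    scattered U -> (\dim {: L} + 2 <= \dim U)%N ->
  exists u w : {ffun 'I_k -> K},
    [/\ u \in U, w \in U, dot x u = 0, dot x w = 0
      & (1 < \rank (row_mx (colv u) (colv w)))%N].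
Proof.
move=> scU dU; set W := (U :&: lker (linfun (dot x)))%VS.
have dW : (2 <= \dim W)%N.
  apply: leq_trans (dim_lker_dot x U).
  by rewrite leq_subRL ?(leq_trans _ dU) ?leq_addr.
pose u := vpick W.
have u0 : u != 0 by rewrite vpick0 -dimv_eq0 -lt0n (ltn_trans _ dW).
have /subvPn[w wW wu] : ~~ (W <= <[u]>)%VS.
  by apply: contraL dW => /dimvS; rewrite dim_vline u0 -leqNgt.
have w0 : w != 0 by apply: contraNneq wu => ->; apply: mem0v.
have := memv_pick W; rewrite -/u; move: wW.
rewrite !memv_cap !memv_ker !lfunE => /andP[wU /eqP xw] /andP[uU /eqP xu].
(* At rank at most 1, [w] would be a K-multiple of [u] and give the same point; scatteredness would
   then put [w] in the F-line of [u], against its choice. *)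
exists u, w; split=> //; rewrite ltnNge; apply: contra wu => rk.
have [||b /(congr1 trmx)] := @rank_col_mx_le1 K k (colv u)^T (colv w)^T.
- apply: contraNneq u0 => /rowP u0; apply/eqP/ffunP => i.
  by have := u0 i; rewrite !mxE ffunE.
- by rewrite -tr_row_mx mxrank_tr.
rewrite linearZ /= !trmxK => wub.
by apply: (scattered_proj_point_inj scU) => //; apply: proj_point_scale wub.
Qed.

Lemma span_colv_eq0 k (U : {vspace {ffun 'I_k -> K}}) (x : 'rV[K]_k) :
    <<[seq colv u | u in U]>>%VS = {: 'cV[K]_k}%VS ->
  (forall u, u \in U -> dot x u = 0) -> x = 0.
Proof.
move=> spU xU; have : ({: 'cV[K]_k} <= lker (linfun (mulmx x)))%VS.
  rewrite -spU; apply/span_subvP => _ /mapP[u + ->]; rewrite mem_enum => uU.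
  by rewrite memv_ker lfunE /= mulmx_colv xU.
move=> /subvP xk; apply/rowP => i.
have := xk (delta_mx i 0) (memvf _); rewrite memv_ker lfunE /= -colE.
by move=> /eqP/colP/(_ 0); rewrite !mxE.
Qed.

End RankMetric.

Theorem theorem6p3 (F : finFieldType) (L : fieldExtType F) (m n : nat)
    (hm : \dim {: L} = m) (hn : (m + 2 <= n)%N)
    (C : {vspace 'rV[finvect_type L]_n})
    (hC : is_code 3%N C) (ndC : nondegenerate_code C)
    (U : {vspace {ffun 'I_3 -> finvect_type L}})
    (hU : is_system n U) (hCU : corresponding_system C U)
    (scU : scattered U) :
  minimal_code C.
Proof.
have [dU spU] := hU; have [G genG UG] := hCU.
move=> v v' /(generator_matrix_mulmx genG)[x ->].
move=> /(generator_matrix_mulmx genG)[x' ->] sub.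
have xx' u : u \in U -> dot x u = 0 -> dot x' u = 0.
  by rewrite UG; apply: rank_support_dot.
(* For [x] zero, [xx'] makes [dot x'] vanish on all of [U], which spans K^3 over K, so [x'] is zero
   too. *)
have [x0|x0] := eqVneq x 0.
  exists 0; rewrite scale0r (span_colv_eq0 spU (x := x')) ?mul0mx // => u uU.
  by apply: xx' => //; rewrite x0 /dot mul0mx mxE.
have [|u [w [uU wU xu xw rk]]] := scattered_rank2 x scU; first by rewrite dU hm.
have xx'0 : col_mx x x' *m row_mx (colv u) (colv w) = 0.
  rewrite mul_col_row; apply/eqP.
  by rewrite block_mx_eq0 !mulmx_colv xu xw !xx' // eqxx.
(* Two matrices with zero product and inner dimension 3 have ranks adding up to at most 3, and the
   right factor has rank at least 2. *)
have rkx : (\rank (col_mx x x') <= 1)%N.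
  rewrite -(leq_add2r 2%N); apply: leq_trans (mulmx0_rank_max xx'0).
  by rewrite leq_add2l.
have [a ->] := rank_col_mx_le1 x0 rkx.
by exists a; rewrite scalemxAl.
Qed.
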